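(* Let $n\geq 2$ and let $\lambda,\mu,\nu\vdash n$. Then: (a) $g(\lambda,\mu,\nu)\leq\binom{n+K-1}{n}$, where $K=\ell(\lambda)\ell(\mu)\ell(\nu)$; (b) $g(\lambda,\mu,\nu)\leq\binom{n+K-1}{n}$, where $K=8\,\delta(\lambda)\delta(\mu)\delta(\nu)$.
   Context: $\mathfrak{S}_n$ is the symmetric group on $n$ elements, and $\mathrm{ch}^\lambda$ is the character of the irreducible complex representation of $\mathfrak{S}_n$ indexed in the usual way by $\lambda\vdash n$ (with $[n]$ corresponding to the trivial representation). The Kronecker coefficient is $$g(\lambda,\mu,\nu)=\frac{1}{n!}\sum_{\sigma\in\mathfrak{S}_n}\mathrm{ch}^\lambda(\sigma)\,\mathrm{ch}^\mu(\sigma)\,\mathrm{ch}^\nu(\sigma).$$ $\ell(\lambda)$ is the number of rows (nonzero parts) of $\lambda$, and $\delta(\lambda)=\max\{i\geq 1:\min(\lambda_i,\lambda_i')\geq i\}$ is its diagonal length, where $\lambda_i$ and $\lambda_i'$ are the lengths of the $i$-th row and $i$-th column. *)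

(* Defs.v *)
From mathcomp Require Import all_boot all_order all_fingroup all_algebra.
From mathcomp Require Import all_solvable all_field all_character.

Set Implicit Arguments.
Unset Strict Implicit.
Unset Printing Implicit Defensive.

Import GroupScope GRing.Theory.
Local Open Scope ring_scope.

(* A partition of n is the weakly decreasing list of its nonzero parts. *)
Definition is_intpart (n : nat) (la : seq nat) : bool :=
  [&& sorted geq la, 0%N \notin la & sumn la == n].

(* Rows and columns are numbered from 1, as in the Young diagram literature. *)
Definition row_len (la : seq nat) (i : nat) : nat := nth 0%N la i.-1.

Definition col_len (la : seq nat) (j : nat) : nat :=
  count (fun p => (j <= p)%N) la.

Definition num_rows (la : seq nat) : nat := size la.

(* Any i >= 1 with la_i >= i satisfies i <= size la, so that the bound on i
   loses nothing. *)
Definition diag_len (la : seq nat) : nat :=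
  (\max_(1 <= i < (size la).+1 |
         i <= minn (row_len la i) (col_len la i)) i)%N.

Section SpechtCharacter.

Variables (n : nat) (la : seq nat).

(* The entries of 'I_n fill the diagram of la row by row: the entry k lies in
   row [reshape_index la k] and column [reshape_offset la k] (from 0). *)
Definition row_stab : {set 'S_n} :=
  [set s : 'S_n | [forall k : 'I_n,
     reshape_index la (s k) == reshape_index la k]].

Definition col_stab : {set 'S_n} :=
  [set s : 'S_n | [forall k : 'I_n,
     reshape_offset la (s k) == reshape_offset la k]].

Definition regSn := regular_repr algC [set: 'S_n].

(* Elements of the group algebra C[S_n] are represented by their action by
   right multiplication; [gring_row] recovers their coordinates. *)
Definition young_symmetrizer :=
  (\sum_(p in row_stab) regSn p)
    *m (\sum_(q in col_stab) (-1) ^+ (odd_perm q) *: regSn q).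

(* The Specht module: the right ideal of C[S_n] generated by the Young
   symmetrizer. Symmetrizing along the rows and antisymmetrizing along the
   columns makes la = [n] give the trivial representation. *)
Definition specht_mx := cyclic_mx regSn (gring_row young_symmetrizer).

Definition specht_module : mxmodule regSn specht_mx :=
  cyclic_mx_module regSn (gring_row young_symmetrizer).

Definition specht_repr := submod_repr specht_module.

Definition specht_char : 'CF([set: 'S_n]) := cfRepr specht_repr.

End SpechtCharacter.

Definition kronecker (n : nat) (la mu nu : seq nat) : algC :=
  (n`!%:R)^-1 * \sum_(s : 'S_n)
    specht_char n la s * specht_char n mu s * specht_char n nu s.

(* Main.v *)
Require Import Defs.
From mathcomp Require Import all_boot all_order all_fingroup all_algebra.
From mathcomp Require Import all_solvable all_field all_character.

(* Write the Specht module as the right ideal abA, with a symmetrizing the rows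
   and b antisymmetrizing the columns. When the diagram fits in the (p|q) hook,
   label each box of the first p rows by its row and each other box by its
   column. Let H be the stabilizer of this labelling by p + q letters, chi the
   sign of the permutation that an element of H induces on the boxes below row
   p, and e the sum of chi(h) h over H. Left multiplication by e embeds abA in
   eA: by von Neumann's lemma a e a b = c ab for a scalar c, and c = 0 would
   give (eab)^*(eab) = 0, although eab has a positive coefficient at 1. The
   character of eA is induced from chi, so that its value at s is bounded by the
   number of words over p + q letters fixed by s. Multiplying three such bounds
   and averaging over S_n, Burnside's lemma bounds g by the number of multisets
   of size n over K letters. Part (a) is the case p = number of rows and q = 0,
   part (b) the case p = q = diagonal length. *)

Set Implicit Arguments.
Unset Strict Implicit.
Unset Printing Implicit Defensive.

Import GroupScope Order.TTheory GRing.Theory Num.Theory.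
Local Open Scope ring_scope.

(** * Characters of submodules *)

(** By Maschke's theorem the image of the embedding has an invariant complement, whose character is
    the difference. *)
Lemma cfRepr_embed_char (gT : finGroupType) (G : {group gT}) (n1 n2 : nat)
    (rG1 : mx_representation algC G n1) (rG2 : mx_representation algC G n2)
    (B : 'M_(n1, n2)) :
  row_free B -> {in G, forall x, rG1 x *m B = B *m rG2 x} ->
  cfRepr rG2 - cfRepr rG1 \is a character.
Proof.
move=> freeB homB; pose U := <<B>>%MS.
have modU: mxmodule rG2 U.
  apply/mxmoduleP=> x Gx; rewrite (eqmxMr _ (genmxE B)) genmxE -homB //.
  exact: submxMl.
have rsimU: mx_rsim rG1 (submod_repr modU).
  have BU : (B <= U)%MS by rewrite genmxE.
  exists (in_submod U B) => [||x Gx].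
  - by rewrite genmxE (eqP freeB).
  - by rewrite /row_free mxrank_in_submod.
  - by rewrite -in_submodJ // -homB // /in_submod /= !mulmxA.
have pG : [pchar algC]^'.-group G by exact: algC'G_pchar.
have [W modW defV dxUW] := mx_Maschke_pchar rG2 pG modU (submx1 _).
have -> : cfRepr rG2 = cfRepr rG1 + cfRepr (submod_repr modW).
  rewrite (cfRepr_sim rsimU); apply/cfun_inP=> x Gx.
  rewrite !cfunE Gx !mulr1n.
  rewrite -(mxtrace_submod1 (mxmodule1 rG2)) //.
  by apply/esym/mxtrace_dadd_mod.
by rewrite addrC addKr cfRepr_char.
Qed.

(** The matrix [c^-1 *: E] is a projection onto the submodule and commutes with [rG x], so composing
    with it turns the trace on the submodule into a trace on the whole space. *)
Lemma cfRepr_submod_idem (gT : finGroupType) (G : {group gT}) (n : nat)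
    (rG : mx_representation algC G n) (E : 'M_n) (c : algC)
    (modE : mxmodule rG E) (x : gT) :
  x \in G -> c != 0 -> E *m E = c *: E -> comm_mx E (rG x) ->
  cfRepr (submod_repr modE) x = c^-1 * \tr (rG x *m E).
Proof.
move=> Gx nzc EE Ec; rewrite cfunE Gx mulr1n /= /submod_mx.
set Q := in_submod E (1%:M : 'M_n); set P := val_submod (1%:M : 'M_(\rank E)).
have EQP: E *m Q *m P = E.
  by rewrite -in_submodE -val_submodE in_submodK.
have PE: P *m E = c *: P.
  have /submxP[D ->] : (P <= E)%MS by rewrite val_submodP.
  by rewrite -mulmxA EE scalemxAr.
rewrite in_submodE -/Q mxtrace_mulC mulmxA.
have -> : Q *m P = c^-1 *: (Q *m P *m E).
  by rewrite -mulmxA PE -scalemxAr scalerA mulVf // scale1r.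
rewrite -scalemxAl mxtraceZ -[_ *m E *m _]mulmxA Ec mxtrace_mulC.
by rewrite -mulmxA [E *m _]mulmxA EQP.
Qed.

(** * Left multiplication in the group algebra and signed sums over subgroups *)

Section LeftRegular.

Variable gT : finGroupType.

Local Notation G := [set: gT].
Local Notation reg := (regular_repr algC [set: gT]%G).

Definition gvec (g : gT) : 'rV[algC]_#|G| :=
  delta_mx 0 (gring_index [set: gT]%G g).

Definition gcoef (v : 'rV[algC]_#|G|) (g : gT) : algC :=
  v 0 (gring_index [set: gT]%G g).

(* Left multiplication by h: as matrices act on row vectors from the right,
   lreg reverses products. *)
Definition lreg (h : gT) : 'M[algC]_#|G| :=
  \matrix_i gvec (h * enum_val i).

Lemma gvec_lreg g h : gvec g *m lreg h = gvec (h * g).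
Proof. by rewrite -rowE rowK gring_indexK ?inE. Qed.

Lemma gvec_reg g h : gvec g *m reg h = gvec (g * h).
Proof. by rewrite -rowE rowK gring_indexK ?inE. Qed.

Lemma gvec_ext (A B : 'M[algC]_#|G|) :
  (forall g, gvec g *m A = gvec g *m B) -> A = B.
Proof.
move=> eqAB; apply/row_matrixP=> i.
by rewrite !rowE -(gring_valK i); apply: eqAB.
Qed.

Lemma gcoef_ext (u v : 'rV[algC]_#|G|) : gcoef u =1 gcoef v -> u = v.
Proof.
move=> equv; apply/rowP=> i.
by rewrite -(gring_valK i); apply: equv.
Qed.

Lemma gcoef_gvec g h : gcoef (gvec g) h = (g == h)%:R.
Proof.
rewrite /gcoef mxE eqxx /= (inj_in_eq (can_in_inj (@gring_indexK _ _))) ?inE //.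
by rewrite eq_sym.
Qed.

Lemma gcoefZ c v g : gcoef (c *: v) g = c * gcoef v g.
Proof. by rewrite /gcoef mxE. Qed.

Lemma gcoef_sum (I : finType) (P : pred I) F g :
  gcoef (\sum_(i | P i) F i) g = \sum_(i | P i) gcoef (F i) g.
Proof. by rewrite /gcoef summxE. Qed.

Lemma gvec_sum (v : 'rV[algC]_#|G|) : v = \sum_g gcoef v g *: gvec g.
Proof.
apply: gcoef_ext => h; rewrite gcoef_sum (bigD1 h) //= gcoefZ gcoef_gvec eqxx.
rewrite mulr1 big1 ?addr0 // => g ne_gh.
by rewrite gcoefZ gcoef_gvec (negPf ne_gh) mulr0.
Qed.

Lemma gcoef_lreg v h g : gcoef (v *m lreg h) g = gcoef v (h^-1 * g).
Proof.
rewrite {1}[v]gvec_sum mulmx_suml gcoef_sum (bigD1 (h^-1 * g)%g) //=.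
rewrite -scalemxAl gcoefZ gvec_lreg gcoef_gvec mulKVg eqxx mulr1 big1 ?addr0 //.
move=> k nek; rewrite -scalemxAl gcoefZ gvec_lreg gcoef_gvec.
by rewrite -(inj_eq (mulgI h^-1)%g) mulKg (negPf nek) mulr0.
Qed.

Lemma gcoef_reg v h g : gcoef (v *m reg h) g = gcoef v (g * h^-1).
Proof.
rewrite {1}[v]gvec_sum mulmx_suml gcoef_sum (bigD1 (g * h^-1)%g) //=.
rewrite -scalemxAl gcoefZ gvec_reg gcoef_gvec mulgKV eqxx mulr1 big1 ?addr0 //.
move=> k nek; rewrite -scalemxAl gcoefZ gvec_reg gcoef_gvec.
by rewrite -(inj_eq (mulIg h^-1)%g) mulgK (negPf nek) mulr0.
Qed.

Lemma lregM h k : lreg h *m lreg k = lreg (k * h).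
Proof. by apply: gvec_ext => g; rewrite mulmxA !gvec_lreg mulgA. Qed.

Lemma lreg_reg h k : comm_mx (lreg h) (reg k).
Proof.
by apply: gvec_ext => g; rewrite !mulmxA !(gvec_lreg, gvec_reg) mulgA.
Qed.

(** Since [lreg h] is a permutation matrix, transposition realizes the involution of the group
    algebra that inverts group elements. *)
Lemma tr_lreg h : (lreg h)^T = lreg h^-1.
Proof.
have ent k i j : lreg k i j = (k * enum_val i == enum_val j)%g%:R.
  by rewrite mxE -gcoef_gvec /gcoef gring_valK.
apply/matrixP=> i j; rewrite mxE !ent; congr (_%:R); congr nat_of_bool.
by rewrite -[RHS](inj_eq (mulgI h)) mulKVg eq_sym.
Qed.

Lemma mxtrace_gcoef (A : 'M[algC]_#|G|) :
  \tr A = \sum_g gcoef (gvec g *m A) g.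
Proof.
rewrite /mxtrace (reindex (gring_index [set: gT]%G)) /=; last first.
  by exists enum_val => [g _ | i _]; rewrite ?gring_valK ?gring_indexK ?inE.
by apply: eq_bigr => g _; rewrite /gcoef /gvec -rowE mxE.
Qed.

(** One construction covers all three elements a, b and e of the group algebra: the constant [false]
    gives a, the parity b, and the sign on the letter stabilizer e. *)
Definition sgn_sum (H : {set gT}) (eps : gT -> bool) : 'M[algC]_#|G| :=
  \sum_(h in H) (-1) ^+ eps h *: lreg h.

Lemma sgn_sum_reg H eps k : comm_mx (sgn_sum H eps) (reg k).
Proof.
rewrite /comm_mx mulmx_suml mulmx_sumr; apply: eq_bigr => h _.
by rewrite -scalemxAl -scalemxAr lreg_reg.
Qed.

Lemma sgn_sum_real H eps : sgn_sum H eps \is a mxOver Num.real.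
Proof.
apply/mxOverP=> i j; rewrite summxE rpred_sum // => h _.
rewrite !mxE rpredM ?rpredX ?rpredN ?rpred1 //.
by case: (_ && _); rewrite ?rpred1 ?rpred0.
Qed.

Section SignCharacter.

Variables (H : {group gT}) (eps : gT -> bool).
Hypothesis epsM : {in H &, forall x y, eps (x * y)%g = eps x (+) eps y}.

Lemma eps1 : eps 1%g = false.
Proof. by have := epsM (group1 H) (group1 H); rewrite mulg1; case: (eps _). Qed.

Lemma epsV : {in H, forall x, eps x^-1%g = eps x}.
Proof.
move=> x Hx; have := epsM Hx (groupVr Hx); rewrite mulgV eps1.
by case: (eps x); case: (eps _).
Qed.

Lemma lreg_sgn_sum h :
  h \in H -> lreg h *m sgn_sum H eps = (-1) ^+ eps h *: sgn_sum H eps.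
Proof.
move=> Hh; rewrite mulmx_sumr scaler_sumr (reindex_inj (mulIg h^-1%g)) /=.
apply: eq_big => [k | k]; first by rewrite groupMr ?groupV.
rewrite groupMr ?groupV // => Hk.
rewrite -scalemxAr lregM mulgKV scalerA epsM ?groupV // epsV //.
by rewrite signr_addb mulrC.
Qed.

Lemma sgn_sum_lreg h :
  h \in H -> sgn_sum H eps *m lreg h = (-1) ^+ eps h *: sgn_sum H eps.
Proof.
move=> Hh; rewrite mulmx_suml scaler_sumr (reindex_inj (mulgI h^-1%g)) /=.
apply: eq_big => [k | k]; first by rewrite groupMl ?groupV.
rewrite groupMl ?groupV // => Hk.
by rewrite -scalemxAl lregM mulKVg scalerA epsM ?groupV // epsV // signr_addb.
Qed.

Lemma sgn_sum_idem : sgn_sum H eps *m sgn_sum H eps = #|H|%:R *: sgn_sum H eps.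
Proof.
rewrite {1}/sgn_sum mulmx_suml -sumr_const scaler_suml; apply: eq_bigr => h Hh.
by rewrite -scalemxAl lreg_sgn_sum // scalerA -signr_addb addbb.
Qed.

Lemma tr_sgn_sum : (sgn_sum H eps)^T = sgn_sum H eps.
Proof.
rewrite /sgn_sum linear_sum /= (reindex_inj invg_inj) /=.
apply: eq_big => [h | h]; rewrite groupV // => Hh.
by rewrite linearZ /= tr_lreg invgK epsV.
Qed.

End SignCharacter.

End LeftRegular.

(** * Young symmetrizers in a finite group with row group [R] and column group [C] *)

Section YoungSymmetrizer.

Variables (gT : finGroupType) (R C H : {group gT}) (epsC epsH : gT -> bool).

Local Notation reg := (regular_repr algC [set: gT]%G).

Hypothesis epsCM : {in C &, forall x y, epsC (x * y)%g = epsC x (+) epsC y}.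
Hypothesis epsHM : {in H &, forall x y, epsH (x * y)%g = epsH x (+) epsH y}.
Hypothesis epsHC : forall p q : gT,
  p \in R -> q \in C -> (p * q)%g \in H -> epsH (p * q)%g = epsC q.
Hypothesis vonNeumann : forall g : gT,
  (exists2 p, p \in R & exists2 q, q \in C & g = (p * q)%g)
  \/ (exists2 t, t \in R & (t ^ g \in C)%g && epsC (t ^ g)%g).

Let A : 'M[algC]_#|[set: gT]| := sgn_sum R (fun=> false).
Let B : 'M[algC]_#|[set: gT]| := sgn_sum C epsC.
Let E : 'M[algC]_#|[set: gT]| := sgn_sum H epsH.

Let epsRM : {in R &, forall x y : gT, false = false (+) false}.
Proof. by []. Qed.

Let young_comm (X : 'M_#|[set: gT]|) :
  (forall s, comm_mx X (reg s)) -> forall s, comm_mx (B *m X *m A) (reg s).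
Proof.
move=> Xreg s; apply: comm_mx_sym.
do !apply: comm_mxM; apply: comm_mx_sym => //.
  exact: sgn_sum_reg.
exact: sgn_sum_reg.
Qed.

(** The element a x b is unchanged by left multiplication by [p], and right multiplication by [q]
    only costs the sign of [q]. *)
Lemma gcoef_young_pq (X : 'M_#|[set: gT]|) p q :
    (forall s, comm_mx X (reg s)) -> p \in R -> q \in C ->
  gcoef (gvec 1%g *m (B *m X *m A)) (p * q)%g
    = (-1) ^+ epsC q * gcoef (gvec 1%g *m (B *m X *m A)) 1%g.
Proof.
move=> Xreg Rp Cq; set M := B *m X *m A.
have lpM: M *m lreg p = M.
  by rewrite -mulmxA sgn_sum_lreg ?groupV //= expr0 scale1r.
have rqM: gvec 1%g *m M *m reg q^-1%g = (-1) ^+ epsC q *: (gvec 1%g *m M).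
  rewrite -mulmxA young_comm // (mulmxA (gvec _)) gvec_reg mul1g.
  rewrite -[q^-1%g]mulg1 -gvec_lreg.
  rewrite -!mulmxA [lreg _ *m _]mulmxA lreg_sgn_sum ?groupV // (epsV epsCM) //.
  by rewrite -!scalemxAl -scalemxAr /M !mulmxA.
rewrite -[RHS]gcoefZ -rqM gcoef_reg invgK mul1g -{1}lpM mulmxA gcoef_lreg.
by rewrite mulKg.
Qed.

(** Write t g = g (t ^ g). Left multiplication by [t] fixes a x b and right multiplication by
    [t ^ g] negates it, so the coefficient at [g] is its own opposite. *)
Lemma gcoef_young_eq0 (X : 'M_#|[set: gT]|) t g :
    (forall s, comm_mx X (reg s)) ->
    t \in R -> (t ^ g)%g \in C -> epsC (t ^ g)%g ->
  gcoef (gvec 1%g *m (B *m X *m A)) g = 0.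
Proof.
move=> Xreg Rt Ct odd_t; set M := B *m X *m A.
have ltM: M *m lreg t = M.
  by rewrite -mulmxA sgn_sum_lreg ?groupV //= expr0 scale1r.
have rtM: gvec 1%g *m M *m reg (t ^ g)^-1%g = -1 *: (gvec 1%g *m M).
  rewrite -mulmxA young_comm // (mulmxA (gvec _)) gvec_reg mul1g.
  rewrite -[((t ^ g)^-1)%g]mulg1 -gvec_lreg.
  rewrite -!mulmxA [lreg _ *m _]mulmxA lreg_sgn_sum ?groupV // (epsV epsCM) //.
  by rewrite odd_t expr1 -!scalemxAl -scalemxAr /M !mulmxA.
have := congr1 (fun v => gcoef v g) rtM.
rewrite gcoef_reg invgK gcoefZ mulN1r conjgE mulKVg.
rewrite -{1}ltM mulmxA gcoef_lreg mulKg => /eqP.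
by rewrite -addr_eq0 -mulr2n mulrn_eq0 => /eqP.
Qed.

(** A triple with h p q = 1 has p q = h^-1 in [H], where the two signs agree by [epsHC]. Hence no
    term is negative, and the triple of identities contributes 1. *)
Lemma young_coef1_gt0 : 0 < gcoef (gvec 1%g *m (B *m A *m E)) 1%g.
Proof.
have ->: gcoef (gvec 1%g *m (B *m A *m E)) 1%g =
    \sum_(q in C) \sum_(p in R) \sum_(h in H)
       (-1) ^+ (epsC q (+) epsH h) * (h * (p * q) == 1)%g%:R.
  rewrite -mulmxA mulmxA [gvec _ *m B]mulmx_sumr mulmx_suml gcoef_sum.
  apply: eq_bigr => q _; rewrite mulmxA [_ *m A]mulmx_sumr mulmx_suml gcoef_sum.
  apply: eq_bigr => p _; rewrite mulmx_sumr gcoef_sum.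
  apply: eq_bigr => h _; rewrite -!(scalemxAr, scalemxAl) !gvec_lreg mulg1.
  by rewrite expr0 scale1r !gcoefZ gcoef_gvec signr_addb mulrCA mulrA.
have term_ge0 q p h : q \in C -> p \in R -> h \in H ->
    0 <= (-1) ^+ (epsC q (+) epsH h) * (h * (p * q) == 1)%g%:R :> algC.
  move=> Cq Rp Hh; have [hpq | _] := eqVneq (h * (p * q))%g 1%g;
    last by rewrite mulr0.
  have def_h: (p * q = h^-1)%g by rewrite -[LHS](mulKg h) hpq mulg1.
  by rewrite -(epsV epsHM) // -def_h epsHC // ?def_h ?groupV // addbb mulr1.
have term1 : (-1) ^+ (epsC 1%g (+) epsH 1%g)
    * (1 * (1 * 1) == 1 :> gT)%g%:R = 1 :> algC.
  by rewrite (eps1 epsCM) (eps1 epsHM) !mulg1 eqxx mulr1.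
rewrite (bigD1 1%g) //= (bigD1 1%g) //= (bigD1 1%g) //= term1.
rewrite -!addrA ltr_wpDr //.
apply: addr_ge0; first by apply: sumr_ge0 => h /andP[Hh _]; apply: term_ge0.
apply: addr_ge0; apply: sumr_ge0.
  by move=> p /andP[Rp _]; apply: sumr_ge0 => h; apply: term_ge0.
move=> q /andP[Cq _]; apply: sumr_ge0 => p Rp; apply: sumr_ge0 => h.
exact: term_ge0.
Qed.

(* B *m X *m A is left multiplication by a x b. *)
Lemma young_vonNeumann (X : 'M_#|[set: gT]|) :
    (forall s, comm_mx X (reg s)) ->
  exists c, B *m X *m A = c *: (B *m A).
Proof.
move=> Xreg; pose Y := B *m 1%:M *m A.
have YE: Y = B *m A by rewrite /Y mulmx1.
have c1 s: comm_mx (1%:M : 'M[algC]_#|[set: gT]|) (reg s).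
  exact/comm_mx_sym/comm_mx1.
(* The case x = 1: the element ab vanishes as soon as its coefficient at 1 does. This would make eab
   vanish too, against [young_coef1_gt0]. *)
have Y0 : gcoef (gvec 1%g *m Y) 1%g = 0 -> gvec 1%g *m Y = 0.
  move=> Y1; apply: gcoef_ext => g; rewrite [RHS]/gcoef mxE.
  have [[p Rp [q Cq ->]] | [t Rt /andP[Ct odd_t]]] := vonNeumann g.
    by rewrite /Y gcoef_young_pq // Y1 mulr0.
  exact: (gcoef_young_eq0 _ Rt).
have nzY1: gcoef (gvec 1%g *m Y) 1%g != 0.
  apply: contraTneq young_coef1_gt0 => /Y0 Y_eq0.
  by rewrite mulmxA -YE Y_eq0 mul0mx /gcoef mxE ltxx.
pose c := gcoef (gvec 1%g *m (B *m X *m A)) 1%g / gcoef (gvec 1%g *m Y) 1%g.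
exists c; rewrite -YE.
have e1 : gvec 1%g *m (B *m X *m A) = c *: (gvec 1%g *m Y).
  apply: gcoef_ext => g; rewrite gcoefZ.
  have [[p Rp [q Cq ->]] | [t Rt /andP[Ct odd_t]]] := vonNeumann g.
    by rewrite !gcoef_young_pq // mulrCA /c divfK.
  by rewrite !(gcoef_young_eq0 _ Rt) ?mulr0.
(* Both sides commute with right multiplications, so agreement at the identity suffices. *)
apply: gvec_ext => g; rewrite -[g]mul1g -gvec_reg -scalemxAr.
rewrite -(mulmxA _ _ (_ *m A)) -(young_comm Xreg) (mulmxA (gvec _)) e1.
by rewrite -(mulmxA _ _ Y) -(young_comm c1) (mulmxA (gvec _)) -scalemxAl.
Qed.

Lemma young_form_neq0 : exists2 c, c != 0 & B *m A *m E *m A = c *: (B *m A).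
Proof.
have Xreg s: comm_mx (A *m E) (reg s).
  by apply/comm_mx_sym/comm_mxM; apply/comm_mx_sym/sgn_sum_reg.
have [c] := young_vonNeumann Xreg; rewrite !mulmxA => def_c; exists c => //.
apply: contraTneq young_coef1_gt0 => c0; set Z := B *m A *m E.
(* The matrix [Z] is left multiplication by eab, and the product collapses to a multiple of
   [B *m A *m E *m A *m B], which contains the factor [c]. *)
have ZZ0: Z *m Z^T = 0.
  rewrite /Z !trmx_mul !(tr_sgn_sum epsRM, tr_sgn_sum epsCM, tr_sgn_sum epsHM).
  rewrite -!mulmxA (mulmxA E) (sgn_sum_idem epsHM) -!(scalemxAr, scalemxAl).
  by rewrite !mulmxA def_c c0 scale0r mul0mx scaler0.
have Zreal: Z \is a mxOver Num.real.
  by rewrite !mxOverM ?sgn_sum_real.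
suff ->: Z = 0 by rewrite mulmx0 /gcoef mxE ltxx.
(* A diagonal entry of [Z *m Z^T] is a sum of squares of the real entries in one row of [Z]. *)
apply/matrixP=> i j; rewrite [RHS]mxE.
have /eqP := congr1 (fun M : 'M_#|[set: gT]| => M i i) ZZ0.
rewrite mxE [X in _ == X]mxE psumr_eq0 => [|k _]; last first.
  by rewrite [Z^T _ _]mxE -expr2 -realEsqr (mxOverP Zreal).
move/allP/(_ j); rewrite mem_index_enum [Z^T _ _]mxE mulf_eq0 orbb.
by move/(_ isT)/eqP.
Qed.

(** On the right ideal abA, left multiplication by e followed by a is the nonzero scalar of
    [young_form_neq0]. *)
Lemma young_mul_inj m (v : 'M_(m, #|[set: gT]|)) :
  (v <= B *m A)%MS -> v *m E = 0 -> v = 0.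
Proof.
case/submxP=> D -> DE; have [c nzc def_c] := young_form_neq0.
apply/eqP; rewrite -(inj_eq (scalerI nzc)) scaler0 scalemxAr -def_c.
by rewrite !mulmxA -(mulmxA D) DE mul0mx.
Qed.

(** The character [theta] is that of eA, induced from the sign on [H]; the bound is the formula for
    an induced character with its signs dropped. *)
Lemma young_sub_char (U : 'M_#|[set: gT]|) (modU : mxmodule reg U) :
    (U <= B *m A)%MS ->
  exists2 theta : 'CF([set: gT]),
      theta - cfRepr (submod_repr modU) \is a character
    & forall s, `|theta s| <= #|[set g | (s ^ g)%g \in H]|%:R / #|H|%:R.
Proof.
move=> sUBA.
have modE: mxmodule reg E.
  by apply/mxmoduleP=> s _; rewrite sgn_sum_reg submxMl.
have nzH : #|H|%:R != 0 :> algC by rewrite pnatr_eq0 -lt0n cardG_gt0.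
exists (cfRepr (submod_repr modE)).
  (* [F] is left multiplication by e, written from the basis of [U] to the basis of [E]. *)
  pose F := in_submod E (val_submod (1%:M : 'M_(\rank U)) *m E).
  apply: (@cfRepr_embed_char _ _ _ _ _ _ F) => [|s _].
    rewrite -kermx_eq0.
    apply/eqP/(@val_submod_inj _ _ U); rewrite linear0.
    apply: young_mul_inj; first exact: submx_trans (val_submodP _) sUBA.
    rewrite val_submodE -mulmxA -(@in_submodK _ _ E _ (_ *m E)) ?submxMl //.
    by rewrite val_submodE mulmxA -/F mulmx_ker mul0mx.
  have valU: val_submod 1%:M *m reg s
      = submod_repr modU s *m val_submod (1%:M : 'M_(\rank U)).
    by rewrite -(val_submodJ modU) ?inE // mul1mx val_submodE.
  rewrite -in_submodJ ?submxMl // -mulmxA sgn_sum_reg.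
  by rewrite [in RHS]mulmxA valU /F /in_submod /= !mulmxA.
move=> s.
rewrite (cfRepr_submod_idem modE _ nzH (sgn_sum_idem epsHM)) ?inE //;
  last exact: sgn_sum_reg.
rewrite normrM normfV normr_nat mulrC ler_wpM2r ?invr_ge0 //.
rewrite mxtrace_gcoef -[in leRHS]sum1_card natr_sum.
rewrite [leRHS](reindex_inj invg_inj) [leRHS]big_mkcond.
apply: le_trans (ler_norm_sum _ _ _) _; apply: ler_sum => g _.
rewrite mulmxA gvec_reg mulmx_sumr gcoef_sum.
(* Only one [h] can send g s back to g, so each diagonal entry is a single sign or 0. *)
have coefE h: gcoef (gvec (g * s)%g *m ((-1) ^+ epsH h *: lreg h)) g
     = (-1) ^+ epsH h * (h == (s ^ g^-1)^-1)%g%:R.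
  rewrite -scalemxAr gvec_lreg gcoefZ gcoef_gvec.
  congr (_ * (nat_of_bool _)%:R).
  rewrite -[RHS](inj_eq (mulIg (g * s)%g)); congr (_ == _).
  have -> : (g * s = s ^ g^-1 * g)%g.
    by rewrite conjgE invgK -!mulgA mulVg mulg1.
  by rewrite mulKg.
rewrite (eq_bigr _ (fun h _ => coefE h)) inE.
case: ifPn => [Hs | nHs].
  rewrite (bigD1 (s ^ g^-1)^-1%g) ?groupV //= eqxx mulr1 big1.
    by rewrite addr0 normr_sign.
  by move=> h /andP[_ /negPf->]; rewrite mulr0.
rewrite big1 ?normr0 // => h Hh; case: eqP => [def_h|]; rewrite ?mulr0 //.
by rewrite -groupV -def_h Hh in nHs.
Qed.

End YoungSymmetrizer.

(** * Stabilizers of labellings and words fixed by a permutation *)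

(** For the labellings [box_row] and [box_col] this is convertible to [row_stab] and [col_stab],
    which thereby become groups. *)
Definition fstab (n : nat) (T : eqType) (f : 'I_n -> T) : {set 'S_n} :=
  [set s : 'S_n | [forall k, f (s k) == f k]].

Lemma fstabP (n : nat) (T : eqType) (f : 'I_n -> T) (s : 'S_n) :
  reflect (forall k, f (s k) = f k) (s \in fstab f).
Proof. by rewrite inE; apply: (iffP forallP) => fs k; apply/eqP. Qed.

Lemma fstab_group_set (n : nat) (T : eqType) (f : 'I_n -> T) :
  group_set (fstab f).
Proof.
apply/group_setP; split=> [|s t /fstabP fs /fstabP ft].
  by apply/fstabP => k; rewrite perm1.
by apply/fstabP => k; rewrite permM ft fs.
Qed.

Canonical fstab_group (n : nat) (T : eqType) (f : 'I_n -> T) : {group 'S_n} :=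
  Group (fstab_group_set f).

Definition fixed_words (n : nat) (T : finType) (s : 'S_n) :
  {set {ffun 'I_n -> T}} :=
  [set w : {ffun 'I_n -> T} | [forall k, w (s k) == w k]].

(** Send [g] to the word k -> f (g k), which [s] fixes when [s ^ g] stabilizes [f]. Each fibre lies
    in one left coset of the stabilizer. *)
Lemma card_conj_fstab (n : nat) (T : finType) (f : 'I_n -> T) (s : 'S_n) :
  (#|[set g : 'S_n | (s ^ g)%g \in fstab f]|
     <= #|fixed_words T s| * #|fstab f|)%N.
Proof.
pose w (g : 'S_n) := [ffun k => f (g k)].
rewrite -sum1_card (partition_big w [in fixed_words T s]) /=; last first.
  move=> g; rewrite !inE => /forallP fsg; apply/forallP => k; rewrite !ffunE.
  by have := fsg (g k); rewrite permJ.
rewrite -sum_nat_const; apply: leq_sum => v _; rewrite sum1dep_card.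
set S := finset _; have [-> | [g]] := set_0Vmem S; first by rewrite cards0.
case/setIdP=> _ /eqP def_v.
rewrite -(card_lcoset (fstab f) g); apply/subset_leq_card/subsetP => h.
case/setIdP=> _; rewrite -def_v mem_lcoset => /eqP/ffunP eq_hg.
apply/fstabP => k; rewrite permM; have := eq_hg (g^-1%g k).
by rewrite !ffunE => ->; rewrite permKV.
Qed.

Definition box_row (n : nat) (la : seq nat) (k : 'I_n) : nat :=
  reshape_index la k.

Definition box_col (n : nat) (la : seq nat) (k : 'I_n) : nat :=
  reshape_offset la k.

(** * Combinatorics of the row-by-row tableau *)

Section Tableau.

Variables (n : nat) (la : seq nat).
Hypothesis sum_la : sumn la = n.

Local Notation row := (@box_row n la).
Local Notation col := (@box_col n la).

Lemma tableau_inj (k l : 'I_n) : row k = row l -> col k = col l -> k = l.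
Proof.
rewrite /box_row /box_col => eqr eqc; apply: val_inj.
by rewrite /= -[LHS](reshape_indexK la) eqr eqc reshape_indexK.
Qed.

Lemma col_lt_row_len (k : 'I_n) : (col k < nth 0 la (row k))%N.
Proof. by rewrite /box_row /box_col reshape_offsetP // sum_la. Qed.

Lemma tableau_box (i j : nat) : (j < nth 0 la i)%N ->
  exists k : 'I_n, (row k == i) && (col k == j).
Proof.
move=> lt_j; have lt_n : (flatten_index la i j < n)%N.
  by rewrite -sum_la flatten_indexP.
exists (Ordinal lt_n); rewrite /box_row /box_col /=.
by rewrite flatten_indexKl ?flatten_indexKr ?eqxx.
Qed.

(* Replacing the column of each box k by that of g k keeps the sum of the
   columns, whereas the left justified diagram is the unique arrangement with
   minimal column sum among those with given row lengths and no repeated box. *)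
Lemma rearranged_boxes (g : 'S_n) :
    (forall k l, row k = row l -> col (g k) = col (g l) -> k = l) ->
  forall k, (col (g k) < nth 0 la (row k))%N.
Proof.
move=> inj_g; pose P k := (col (g k) < nth 0 la (row k))%N.
(* The box in the row of [k] and the column of [g k]. Under [P] it exists, so the default [k] of
   [insubd] does not occur there. *)
pose f (k : 'I_n) : 'I_n := insubd k (flatten_index la (row k) (col (g k))).
have fE k : P k -> row (f k) = row k /\ col (f k) = col (g k).
  move=> Pk; have lt_n : (flatten_index la (row k) (col (g k)) < n)%N.
    by rewrite -[X in (_ < X)%N]sum_la flatten_indexP.
  by rewrite /box_row /box_col val_insubd lt_n flatten_indexKl ?flatten_indexKr.
have injf : {in P &, injective f}.
  move=> k l Pk Pl eq_f; have [rk ck] := fE k Pk; have [rl cl] := fE l Pl.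
  by apply: inj_g; rewrite -?rk -?rl -?ck -?cl eq_f.
pose a k := (nth 0 la (row k) - col k)%N.
pose b k := (nth 0 la (row k) - col (g k))%N.
(* Without truncation the two sums would be equal, as [g] permutes the columns; truncated
   subtraction can only enlarge the terms of [b]. *)
have le_ab: (\sum_k a k <= \sum_k b k)%N.
  rewrite -(leq_add2r (\sum_k col k)) -big_split /=.
  rewrite [X in (_ <= _ + X)%N](reindex_inj (@perm_inj _ g)) -big_split /=.
  apply: leq_sum => k _; rewrite subnK ?(ltnW (col_lt_row_len k)) //.
  by rewrite addnC -leq_subLR.
have sum_b: (\sum_k b k = \sum_(m in f @: P) a m)%N.
  rewrite big_imset //= (bigID P) /= addnC big1 ?add0n.
    by apply: eq_bigr => k Pk; rewrite /a; have [-> ->] := fE k Pk.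
  by move=> k; rewrite /P -leqNgt /b -subn_eq0 => /eqP.
(* Every [a m] is positive, so a box outside the image of [f] would make the sum of [b] strictly
   smaller than that of [a]. *)
have fullP: f @: P = [set: 'I_n].
  apply/eqP; rewrite eqEsubset subsetT; apply/subsetP => m _.
  apply: contraLR le_ab => nPm; rewrite -ltnNge sum_b.
  rewrite [ltnRHS](bigID [in f @: P]) /= -[ltnLHS]addn0 ltn_add2l.
  by rewrite (bigD1 m) //= ltn_addr // subn_gt0 (col_lt_row_len m).
have cardP : #|predC P| = 0%N.
  apply/eqP; rewrite -(eqn_add2l #|P|) cardC addn0.
  by rewrite -(card_in_imset injf) fullP cardsT.
move=> k; apply/negPn/negP => nPk.
by have := card0_eq cardP k; rewrite !inE nPk.
Qed.

(** If [g] sends two boxes of one row to the same column, their transposition is [t]. Otherwise [p]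
    moves each box [k] within its row to the column of [g k], and p^-1 g preserves columns. *)
Lemma row_col_factor (g : 'S_n) :
  (exists2 p, p \in fstab row & exists2 q, q \in fstab col & g = (p * q)%g)
  \/ (exists2 t,
        t \in fstab row & (t ^ g \in fstab col)%g && odd_perm (t ^ g)%g).
Proof.
have [/existsP[k /existsP[l /and3P[ne_kl /eqP eqr /eqP eqc]]] | noc] :=
   boolP [exists k : 'I_n, exists l : 'I_n,
            [&& k != l, row k == row l & col (g k) == col (g l)]].
  right; exists (tperm k l); first by apply/fstabP => m; case: tpermP => // ->.
  rewrite tpermJ odd_tperm (inj_eq perm_inj) ne_kl andbT.
  by apply/fstabP => m; case: tpermP => // ->.
have inj_g k l : row k = row l -> col (g k) = col (g l) -> k = l.
  move=> eqr eqc; apply/eqP; apply: contraR noc => ne_kl.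
  apply/existsP; exists k; apply/existsP; exists l.
  by rewrite ne_kl eqr eqc !eqxx.
have box k := tableau_box (rearranged_boxes inj_g k).
pose h k := xchoose (box k).
have hE k : row (h k) = row k /\ col (h k) = col (g k).
  by have /andP[/eqP-> /eqP->] := xchooseP (box k).
have inj_h : injective h.
  move=> k l eq_h; have [rk ck] := hE k; have [rl cl] := hE l.
  by apply: inj_g; rewrite -?rk -?rl -?ck -?cl eq_h.
left; exists (perm inj_h).
  by apply/fstabP => k; rewrite permE; case: (hE k).
exists ((perm inj_h)^-1 * g)%g; last by rewrite mulKVg.
apply/fstabP => k; rewrite permM; have [_ /= <-] := hE ((perm inj_h)^-1%g k).
by rewrite -(permE inj_h) permKV.
Qed.

End Tableau.

(** * Bounding Specht characters by words over hook letters *)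

(** The bound is the permutation character on words. It concerns the absolute value because [theta]
    is induced from a sign and may be negative. *)
Definition word_dominated (n d : nat) (chi : 'CF([set: 'S_n])) : Prop :=
  exists2 theta : 'CF([set: 'S_n]), theta - chi \is a character
    & forall s, `|theta s| <= #|fixed_words 'I_d s|%:R.

Section HookLetters.

Variables (n : nat) (la : seq nat) (p q : nat).
Hypothesis sum_la : sumn la = n.
Hypothesis hook_la : forall k : 'I_n,
  (p <= box_row la k)%N -> (box_col la k < q)%N.

Local Notation row := (@box_row n la).
Local Notation col := (@box_col n la).

Definition hook_letter_nat (k : 'I_n) : nat :=
  if (row k < p)%N then row k else (p + col k)%N.

Lemma hook_letter_subproof k : (hook_letter_nat k < p + q)%N.
Proof.
rewrite /hook_letter_nat; have [lt_kp | le_pk] := ltnP (row k) p.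
  exact: ltn_addr.
by rewrite ltn_add2l hook_la.
Qed.

Definition hook_letter (k : 'I_n) : 'I_(p + q) :=
  Ordinal (hook_letter_subproof k).

Definition odd_boxes : {set 'I_n} := [set k | (p <= row k)%N].

(** As [restr_perm] is trivial on permutations that do not preserve [odd_boxes], multiplicativity is
    claimed only on the letter stabilizer. *)
Definition hook_sign (s : 'S_n) : bool := odd_perm (restr_perm odd_boxes s).

Lemma hook_letter_eq k l : hook_letter k = hook_letter l ->
  (k \in odd_boxes) = (l \in odd_boxes)
  /\ if k \in odd_boxes then col k = col l else row k = row l.
Proof.
move/(congr1 val); rewrite /= /hook_letter_nat !inE.
case: ltnP => hk; case: ltnP => hl // eq_kl.
- by rewrite eq_kl ltnNge leq_addr in hk.
- by rewrite -eq_kl ltnNge leq_addr in hl.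
- by have /addnI := eq_kl.
Qed.

Lemma hook_stab_norm : fstab hook_letter \subset 'N(odd_boxes | 'P).
Proof.
apply/subsetP => s /fstabP hs; apply/astabsP => k /=.
by have [-> _] := hook_letter_eq (hs k).
Qed.

Lemma hook_signM :
  {in fstab hook_letter &, forall s t,
     hook_sign (s * t)%g = hook_sign s (+) hook_sign t}.
Proof.
move=> s t Hs Ht; rewrite /hook_sign -odd_permM.
by rewrite -(morphM (restr_perm_morphism odd_boxes)) ?(subsetP hook_stab_norm).
Qed.

(** On odd boxes the product preserves columns, as does [t], which forces [s] to fix them. On the
    other boxes it preserves rows, as does [s], which forces [t] to fix them. So the restricted
    permutation is [t] itself. *)
Lemma hook_sign_col (s t : 'S_n) :
    s \in fstab row -> t \in fstab col -> (s * t)%g \in fstab hook_letter ->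
  hook_sign (s * t)%g = t.
Proof.
move=> /fstabP Rs /fstabP Ct Hst; have /fstabP hst := Hst.
rewrite /hook_sign; congr (odd_perm _); apply/permP => k.
have [odd_k | even_k] := boolP (k \in odd_boxes).
  rewrite restr_permE ?(subsetP hook_stab_norm) // permM; congr (t _).
  have [odd_st] := hook_letter_eq (hst k).
  rewrite odd_st odd_k permM Ct => eqc.
  by apply: (tableau_inj (la := la)).
rewrite (out_perm (restr_perm_on _ _)) //.
(* The box to test is the one that [s] sends to [k]. *)
have [odd_st] := hook_letter_eq (hst (s^-1%g k)).
rewrite odd_st permM permKV [_ \in _]inE -[row _]Rs permKV.
have := even_k; rewrite inE => /negPf-> eqr.
by apply/esym/(tableau_inj (la := la)); rewrite ?Ct.
Qed.

(** Right multiplication by a then b, and left multiplication by b then a, both send 1 to ab; the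
    two sides are exchanged because they commute. *)
Lemma young_symmetrizer_row :
  gring_row (young_symmetrizer n la)
    = gvec 1%g *m (sgn_sum (fstab col) (fun s : 'S_n => odd_perm s)
                   *m sgn_sum (fstab row) (fun=> false)).
Proof.
rewrite /gring_row rowE -/(gvec 1%g) /young_symmetrizer.
set Q := (X in _ *m (_ *m X) = _); rewrite [LHS]mulmxA.
have -> : gvec 1%g *m (\sum_(s in row_stab n la) regSn n s)
    = gvec 1%g *m sgn_sum (fstab row) (fun=> false).
  rewrite !mulmx_sumr; apply: eq_bigr => s _.
  by rewrite expr0 scale1r gvec_lreg gvec_reg mul1g mulg1.
have QE : gvec 1%g *m Q
    = gvec 1%g *m sgn_sum (fstab col) (fun s : 'S_n => odd_perm s).
  rewrite !mulmx_sumr; apply: eq_bigr => s _.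
  by rewrite -!scalemxAr gvec_lreg gvec_reg mul1g mulg1.
have AQ : comm_mx (sgn_sum (fstab row) (fun=> false)) Q.
  rewrite /comm_mx mulmx_sumr mulmx_suml; apply: eq_bigr => s _.
  by rewrite -scalemxAr -scalemxAl sgn_sum_reg.
by rewrite -[LHS]mulmxA AQ [LHS]mulmxA QE -mulmxA.
Qed.

Lemma specht_word_dominated : word_dominated (p + q) (specht_char n la).
Proof.
have signM : {in fstab col &, forall s t : 'S_n,
    odd_perm (s * t)%g = odd_perm s (+) odd_perm t}.
  by move=> s t _ _; rewrite odd_permM.
have sub_young : (specht_mx n la
    <= sgn_sum (fstab col) (fun s : 'S_n => odd_perm s)
       *m sgn_sum (fstab row) (fun=> false))%MS.
  apply: cyclic_mx_sub; last by rewrite young_symmetrizer_row submxMl.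
  apply/mxmoduleP=> s _; rewrite -mulmxA sgn_sum_reg mulmxA sgn_sum_reg -mulmxA.
  exact: submxMl.
have [theta charT normT] := young_sub_char signM hook_signM hook_sign_col
    (row_col_factor sum_la) (specht_module n la) sub_young.
exists theta => // s; apply: le_trans (normT s) _.
rewrite ler_pdivrMr ?ltr0n ?cardG_gt0 // -natrM ler_nat.
exact: card_conj_fstab.
Qed.

End HookLetters.

(** * Counting fixed words and orbits of words *)

Lemma leq_fixed_words (n : nat) (T T' : finType) (f : T -> T') (s : 'S_n) :
  injective f -> (#|fixed_words T s| <= #|fixed_words T' s|)%N.
Proof.
move=> injf; pose F (w : {ffun 'I_n -> T}) := [ffun k => f (w k)].
have injF : injective F.
  move=> v w /ffunP eqF; apply/ffunP => k; apply: injf.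
  by have := eqF k; rewrite !ffunE.
rewrite -(card_imset _ injF).
apply/subset_leq_card/subsetP => _ /imsetP[w + ->].
by rewrite !inE => /forallP fw; apply/forallP => k; rewrite !ffunE (eqP (fw k)).
Qed.

Lemma fixed_words_pair (n : nat) (T T' : finType) (s : 'S_n) :
  (#|fixed_words T s| * #|fixed_words T' s|
     <= #|fixed_words (T * T')%type s|)%N.
Proof.
pose F (w : {ffun 'I_n -> T} * {ffun 'I_n -> T'}) := [ffun k => (w.1 k, w.2 k)].
have injF : injective F.
  move=> [v v'] [w w'] /ffunP eqF.
  by congr (_, _); apply/ffunP => k; have := eqF k; rewrite !ffunE => -[].
rewrite -cardsX -(card_imset _ injF).
apply/subset_leq_card/subsetP => _ /imsetP[[w w'] + ->].
rewrite !inE /= => /andP[/forallP fw /forallP fw']; apply/forallP => k.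
by rewrite !ffunE /= (eqP (fw k)) (eqP (fw' k)).
Qed.

Section WordAction.

Variables (n : nat) (T : finType).

(** The inverse makes this a right action. *)
Definition word_act (w : {ffun 'I_n -> T}) (s : 'S_n) : {ffun 'I_n -> T} :=
  [ffun k => w (s^-1%g k)].

Lemma word_act1 : word_act^~ 1%g =1 id.
Proof. by move=> w; apply/ffunP => k; rewrite ffunE invg1 perm1. Qed.

Lemma word_actM w : act_morph word_act w.
Proof.
by move=> s t; apply/ffunP => k; rewrite !ffunE invMg permM.
Qed.

Definition word_action := TotalAction word_act1 word_actM.

Lemma fixed_wordsE s : fixed_words T s = 'Fix_([set: _] | word_action)[s].
Proof.
apply/setP => w; rewrite !inE sub1set inE.
apply/forallP/eqP => [fw | /ffunP fw k].
  by apply/ffunP => k; rewrite ffunE -{2}[k](permKV s) (eqP (fw _)).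
by have := fw (s k); rewrite ffunE permK => ->.
Qed.

End WordAction.

Lemma sorted_word (n m : nat) (w : {ffun 'I_n -> 'I_m}) :
  exists2 v, v \in orbit (word_action n 'I_m) [set: 'S_n] w
    & sorted leq (map val [tuple v i | i < n]).
Proof.
pose t := [tuple w i | i < n].
have /tuple_permP[s def_s] : perm_eq (sort (fun i j : 'I_m => (i <= j)%N) t) t.
  by rewrite perm_sort.
exists [ffun i => w (s i)].
  apply/imsetP; exists s^-1%g; rewrite ?inE //.
  by apply/ffunP => i; rewrite !ffunE invgK.
have -> : [tuple [ffun i => w (s i)] i | i < n]
   = sort (fun i j : 'I_m => (i <= j)%N) t :> seq _.
  rewrite def_s; congr tval; apply: eq_mktuple => i.
  by rewrite ffunE tnth_mktuple.
by rewrite sorted_map; apply: sort_sorted => i j; apply: leq_total.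
Qed.

(** Each orbit contains a weakly increasing word, and such words are the multisets of [n]
    letters. *)
Lemma card_word_orbits (n m : nat) :
  (#|orbit (word_action n 'I_m.+1) [set: 'S_n] @: [set: {ffun 'I_n -> 'I_m.+1}]|
    <= 'C(n + m, n))%N.
Proof.
rewrite -card_sorted_tuples.
pose W (t : n.-tuple 'I_m.+1) := [ffun i => tnth t i].
pose O t := orbit (word_action n 'I_m.+1) [set: 'S_n] (W t).
apply: leq_trans (leq_imset_card O _).
apply/subset_leq_card/subsetP => _ /imsetP[w _ ->].
have [v wv sorted_v] := sorted_word w.
apply/imsetP; exists [tuple v i | i < n]; first by rewrite inE.
rewrite /= -(orbit_eqP wv); congr (orbit _ _ _); apply/ffunP => i.
by rewrite ffunE tnth_mktuple.
Qed.

Lemma sum_fixed_words (n m : nat) :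
  (\sum_(s : 'S_n) #|fixed_words 'I_m.+1 s| <= 'C(n + m, n) * n`!)%N.
Proof.
have actsT :
    [acts [set: 'S_n], on [set: {ffun 'I_n -> 'I_m.+1}] | word_action n _].
  by apply/actsP => s _ w; rewrite !inE.
have <- : #|[set: 'S_n]| = n`! by rewrite cardsT card_Sn.
apply: leq_trans (leq_mul (card_word_orbits n m) (leqnn _)).
rewrite -(Frobenius_Cauchy actsT).
rewrite [leqRHS](eq_bigl predT) => [|s]; last by rewrite inE.
by apply: leq_sum => s _; rewrite fixed_wordsE.
Qed.

(** * The bound on Kronecker coefficients *)

(** The gap is the multiplicity of the trivial character in a product of characters, hence a natural
    number. *)
Lemma cfdot_char_mono (gT : finGroupType) (G : {group gT})
    (chi theta psi : 'CF(G)) :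
  theta - chi \is a character -> psi \is a character ->
  '[chi * psi, 1] <= '[theta * psi, 1].
Proof.
move=> chi_theta psi_char; rewrite -subr_ge0 -cfdotBl -mulrBl.
by rewrite natr_ge0 // Cnat_cfdot_char ?rpredM ?cfun1_char.
Qed.

Lemma leq_fixed_words3 (n d1 d2 d3 m : nat) (s : 'S_n) :
  (d1 * d2 * d3 = m ->
   #|fixed_words 'I_d1 s| * #|fixed_words 'I_d2 s| * #|fixed_words 'I_d3 s|
     <= #|fixed_words 'I_m s|)%N.
Proof.
move=> def_m; apply: leq_trans (leq_mul (fixed_words_pair _ _ s) (leqnn _)) _.
apply: leq_trans (fixed_words_pair _ _ s) _.
have cardT : #|{: 'I_d1 * 'I_d2 * 'I_d3}| = m by rewrite !card_prod !card_ord.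
by apply: leq_fixed_words (inj_comp (@cast_ord_inj _ _ cardT) enum_rank_inj).
Qed.

Lemma kronecker_le (n : nat) (la mu nu : seq nat) (d1 d2 d3 : nat) :
    word_dominated d1 (specht_char n la) ->
    word_dominated d2 (specht_char n mu) ->
    word_dominated d3 (specht_char n nu) -> (0 < d1 * d2 * d3)%N ->
  kronecker n la mu nu <= 'C(n + d1 * d2 * d3 - 1, n)%:R.
Proof.
case=> th1 char1 norm1 [th2 char2 norm2] [th3 char3 norm3].
case def_m: (d1 * d2 * d3)%N => [//|m] _.
have specht_is_char kap : specht_char n kap \is a character.
  exact: cfRepr_char.
have thetaE kap th :
    th - specht_char n kap \is a character -> th \is a character.
  by move=> charD; rewrite -(subrK (specht_char n kap) th) rpredD.
have [cth1 cth2 cth3] :=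
  And3 (thetaE _ _ char1) (thetaE _ _ char2) (thetaE _ _ char3).
have cardS : #|[set: 'S_n]| = n`! by rewrite cardsT card_Sn.
have avgE (phi : 'CF([set: 'S_n])) :
    '[phi, 1] = n`!%:R^-1 * \sum_(s : 'S_n) phi s.
  rewrite cfdotE cardS; congr (_ * _).
  apply: eq_big => [s | s _]; first by rewrite inE.
  by rewrite cfun1E inE conjC1 mulr1.
pose chi := specht_char n la * specht_char n mu * specht_char n nu.
have -> : kronecker n la mu nu = '[chi, 1].
  by rewrite avgE; congr (_ * _); apply: eq_bigr => s _; rewrite !cfunE.
(* The factors are replaced one at a time, while the other two still form a character. *)
have le_theta : '[chi, 1] <= '[th1 * th2 * th3, 1].
  rewrite /chi -mulrA; apply: le_trans (cfdot_char_mono char1 _) _.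
    by rewrite rpredM ?specht_is_char.
  rewrite mulrCA; apply: le_trans (cfdot_char_mono char2 _) _.
    by rewrite rpredM ?specht_is_char.
  rewrite mulrA mulrC; apply: le_trans (cfdot_char_mono char3 _) _.
    by rewrite rpredM ?specht_is_char.
  by rewrite mulrC [th2 * _]mulrC.
(* The inner product is a multiplicity and equals its absolute value, so the triangle inequality
   applies to the average. *)
apply: le_trans le_theta _; rewrite -[leLHS]ger0_norm; last first.
  by rewrite natr_ge0 // Cnat_cfdot_char ?rpredM ?cfun1_char.
rewrite avgE normrM normfV normr_nat mulrC ler_pdivrMr ?ltr0n ?fact_gt0 //.
apply: le_trans (ler_norm_sum _ _ _) _; rewrite addnS subn1 /= -natrM.
have := sum_fixed_words n m; rewrite -(ler_nat algC).
move/(le_trans _); apply.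
rewrite natr_sum; apply: ler_sum => s _.
have := leq_fixed_words3 s def_m; rewrite -(ler_nat algC).
move/(le_trans _); apply.
by rewrite !cfunE !normrM !natrM !ler_pM ?mulr_ge0.
Qed.

(** * Diagonal length and the final choice of letters *)

(** With d the diagonal length, a box whose row and column, from 0, are both at least d would put a
    square of side d + 1 in the diagram, against the maximality of d. *)
Lemma hook_box (n : nat) (la : seq nat) (k : 'I_n) :
    is_intpart n la -> (diag_len la <= box_row la k)%N ->
  (box_col la k < diag_len la)%N.
Proof.
case/and3P=> sorted_la _ /eqP sum_la le_dr; rewrite ltnNge; apply/negP=> le_dc.
have lt_c := col_lt_row_len sum_la k.
set d := diag_len la in le_dr le_dc *.
have lt_rs : (box_row la k < size la)%N by rewrite reshape_indexP ?sum_la.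
have geq_trans : transitive geq.
  by move=> x y z /= le_xy le_zx; apply: leq_trans le_xy.
have le_nth i : (i <= d)%N -> (d < nth 0%N la i)%N.
  move=> le_id; apply: leq_ltn_trans le_dc (leq_trans lt_c _).
  have le_ir := leq_trans le_id le_dr.
  apply: (sorted_leq_nth geq_trans leqnn 0%N sorted_la) => //.
  exact: leq_ltn_trans lt_rs.
suff: (d.+1 <= d)%N by rewrite ltnn.
rewrite {2}/d /diag_len; apply: (@leq_bigmax_seq _ _ _ id).
  by rewrite mem_index_iota /= ltnS (leq_ltn_trans le_dr lt_rs).
(* Rows count from 1 in [row_len], so row [d.+1] is the entry of index [d]; column [d.+1] meets at
   least the first [d.+1] rows. *)
rewrite leq_min /row_len /= le_nth //= /col_len -[leqRHS]/(count (leq d.+1) la).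
have lt_ds := leq_ltn_trans le_dr lt_rs.
have : all (leq d.+1) (take d.+1 la).
  apply/(all_nthP 0%N) => i; rewrite size_takel // => le_id.
  by rewrite nth_take // le_nth.
rewrite all_count size_takel // => /eqP take_d.
by rewrite -[in leqRHS](cat_take_drop d.+1 la) count_cat take_d leq_addr.
Qed.

(** Were the diagonal length 0, [hook_box] would put the first box in a column below 0. *)
Lemma diag_len_gt0 (n : nat) (la : seq nat) :
  (0 < n)%N -> is_intpart n la -> (0 < diag_len la)%N.
Proof.
move=> n_gt0 la_n; have := @hook_box n la (Ordinal n_gt0) la_n.
by case: (diag_len la) => // /(_ isT).
Qed.

Lemma num_rows_gt0 (n : nat) (la : seq nat) :
  (0 < n)%N -> is_intpart n la -> (0 < num_rows la)%N.
Proof. by case: la => //= n_gt0 /and3P[_ _ /eqP n0]; rewrite -n0 in n_gt0. Qed.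

Theorem proposition5p1 (n : nat) (la mu nu : seq nat)
    (hn : (2 <= n)%N)
    (hla : is_intpart n la) (hmu : is_intpart n mu) (hnu : is_intpart n nu) :
  (kronecker n la mu nu <=
     'C(n + num_rows la * num_rows mu * num_rows nu - 1, n)%:R)%R
  /\
  (kronecker n la mu nu <=
     'C(n + 8 * (diag_len la * diag_len mu * diag_len nu) - 1, n)%:R)%R.
Proof.
have n_gt0 : (0 < n)%N by exact: ltnW.
have sum_part kap : is_intpart n kap -> sumn kap = n by case/and3P=> _ _ /eqP.
have rows kap :
    is_intpart n kap -> word_dominated (num_rows kap) (specht_char n kap).
  (* With [q = 0] the hook condition is vacuous, since every box lies in the first [size kap]
     rows. *)
  move=> kap_n; rewrite /num_rows -[size kap]addn0.
  apply: (specht_word_dominated (sum_part _ kap_n)) => k.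
  by rewrite leqNgt reshape_indexP ?(sum_part _ kap_n).
have diag kap : is_intpart n kap ->
    word_dominated (diag_len kap + diag_len kap) (specht_char n kap).
  move=> kap_n; apply: (specht_word_dominated (sum_part _ kap_n)) => k.
  exact: hook_box.
split.
  apply: kronecker_le; rewrite ?muln_gt0 ?(num_rows_gt0 n_gt0) //; exact: rows.
(* The factor 8 is 2 cubed: each of the three hooks uses twice the diagonal length in letters. *)
have -> : (8 * (diag_len la * diag_len mu * diag_len nu) =
   (diag_len la + diag_len la) * (diag_len mu + diag_len mu)
     * (diag_len nu + diag_len nu))%N.
  by rewrite !addnn -!mul2n (mulnACA 2 _ 2) mulnACA.
apply: kronecker_le; rewrite ?muln_gt0 ?addn_gt0 ?(diag_len_gt0 n_gt0) //;
  exact: diag.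
Qed.
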